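(* Every $q$-matroid $\mathcal{M}=(E,\rho)$ is a direct sum of irreducible $q$-matroids, and the summands are unique up to equivalence: if $\mathcal{M}\approx\mathcal{M}_1\oplus\cdots\oplus\mathcal{M}_t$ and $\mathcal{M}\approx\mathcal{N}_1\oplus\cdots\oplus\mathcal{N}_s$ with all $\mathcal{M}_i,\mathcal{N}_j$ irreducible, then $s=t$ and, after reordering, $\mathcal{M}_i\approx\mathcal{N}_i$ for all $i$.
   Context: Let $\mathbb{F}=\mathbb{F}_q$. A $q$-matroid is $\mathcal{M}=(E,\rho)$, $E$ a finite-dimensional $\mathbb{F}$-vector space, $\rho$ defined on subspaces with $0\le\rho(V)\le\dim V$, monotone and submodular ($\rho(V+W)+\rho(V\cap W)\le\rho(V)+\rho(W)$). Two $q$-matroids $(E_1,\rho_1),(E_2,\rho_2)$ are equivalent ($\approx$) if there is an $\mathbb{F}$-isomorphism $\alpha:E_1\to E_2$ with $\rho_2(\alpha(V))=\rho_1(V)$ for all subspaces $V$. Direct sum: for $q$-matroids $\mathcal{M}_i=(E_i,\rho_i)$ and $E=E_1\oplus E_2$ with projections $\pi_i:E\to E_i$, $\mathcal{M}_1\oplus\mathcal{M}_2=(E,\rho)$ where $\rho(V)=\dim V+\min_{X\le V}(\rho_1(\pi_1(X))+\rho_2(\pi_2(X))-\dim X)$; this operation is associative, so iterated direct sums $\mathcal{M}_1\oplus\cdots\oplus\mathcal{M}_t$ are well defined. We write $\mathcal{M}=\mathcal{M}_1\oplus\mathcal{M}_2$ when $E$ is the internal direct sum of $E_1,E_2$ and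 the rank functions agree. A $q$-matroid is reducible if $\mathcal{M}=\mathcal{M}_1\oplus\mathcal{M}_2$ with both ground spaces nonzero, and irreducible otherwise.
   Formalization: The irreducible summands are required to have nonzero ground space (the zero q-matroid, irreducible by the definition, would break uniqueness since M ≈ M ⊕ 0); a q-matroid on the zero space is the empty direct sum. *)

(* Defs.v *)
From HB Require Import structures.
From mathcomp Require Import all_boot all_order all_algebra all_fingroup.
From mathcomp Require Import boolp.
Set Implicit Arguments. Unset Strict Implicit. Unset Printing Implicit Defensive.
Import GRing.Theory.
Local Open Scope ring_scope.

Section QMatroid.
Variable F : finFieldType.

(* q-matroid axioms for a rank function rho on the subspaces of a ground
   subspace W of an ambient space E (rho is only constrained on subspaces
   of W).  With W = fullv this is the usual notion. *)
Definition qmatroid_on (E : vectType F) (W : {vspace E})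
    (rho : {vspace E} -> nat) : Prop :=
  [/\ (forall V : {vspace E}, (V <= W)%VS -> (rho V <= \dim V)%N),
      (forall V U : {vspace E}, (V <= U)%VS -> (U <= W)%VS -> (rho V <= rho U)%N)
    & (forall V U : {vspace E}, (V <= W)%VS -> (U <= W)%VS ->
          (rho (V + U)%VS + rho (V :&: U)%VS <= rho V + rho U)%N)].

Lemma minsub_ex (E : vectType F) (V : {vspace E}) (f : {vspace E} -> nat) :
  exists n, `[< exists2 X : {vspace E}, (X <= V)%VS & f X = n >].
Proof. by exists (f 0%VS); apply/asboolP; exists 0%VS; rewrite ?sub0v. Qed.

Definition minsub (E : vectType F) (V : {vspace E}) (f : {vspace E} -> nat) : nat :=
  ex_minn (minsub_ex V f).

Record qmat := QMat { qm_E : vectType F; qm_rho : {vspace qm_E} -> nat }.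
Arguments qm_rho : clear implicits.

Definition is_qmatroid (M : qmat) : Prop := qmatroid_on (fullv : {vspace qm_E M}) (qm_rho M).

Definition qequiv (M N : qmat) : Prop :=
  exists alpha : 'Hom(qm_E M, qm_E N),
    bijective alpha /\ forall V : {vspace qm_E M}, qm_rho N (alpha @: V)%VS = qm_rho M V.

(* External direct sum on E1 x E2:
   rho V = dim V + min_{X <= V} (rho1 (pi1 X) + rho2 (pi2 X) - dim X),
   written as min_{X <= V} (rho1 (pi1 X) + rho2 (pi2 X) + dim V - dim X)
   to stay in nat (dim X <= dim V). *)
Definition dsum (M1 M2 : qmat) : qmat :=
  @QMat (qm_E M1 * qm_E M2)%type (fun V =>
    minsub V (fun X => qm_rho M1 (linfun (@fst (qm_E M1) (qm_E M2)) @: X)%VS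
                     + qm_rho M2 (linfun (@snd (qm_E M1) (qm_E M2)) @: X)%VS
                     + \dim V - \dim X)%N).

Definition qzero : qmat := @QMat 'rV[F]_0 (fun _ => 0%N).

Fixpoint dsums (s : seq qmat) : qmat :=
  match s with
  | [::] => qzero
  | [:: M] => M
  | M :: s' => dsum M (dsums s')
  end.

(* Internal direct sum M = M1 (+) M2 with M_i = (E_i, rho_i), E = E1 (+) E2,
   pi_i the projections along the decomposition; reducible if both E_i are
   nonzero. *)
Definition reducible (M : qmat) : Prop :=
  exists (E1 E2 : {vspace qm_E M}) (rho1 rho2 : {vspace qm_E M} -> nat),
    [/\ E1 != 0%VS, E2 != 0%VS, (E1 :&: E2 = 0)%VS & (E1 + E2 = fullv)%VS] /\
    qmatroid_on E1 rho1 /\ qmatroid_on E2 rho2 /\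
        (forall V : {vspace qm_E M},
          qm_rho M V = minsub V (fun X => rho1 (daddv_pi E1 E2 @: X)%VS
                                       + rho2 (daddv_pi E2 E1 @: X)%VS
                                       + \dim V - \dim X)%N).

Definition irreducible (M : qmat) : Prop := ~ reducible M.

Definition irr_summand (M : qmat) : Prop :=
  [/\ is_qmatroid M, irreducible M & (0 < \dim (fullv : {vspace qm_E M}))%N].

End QMatroid.

(* Main.v *)
Require Import Defs.
From HB Require Import structures.
From mathcomp Require Import all_boot all_order all_algebra all_fingroup.
From mathcomp Require Import boolp zify.

(* A decomposition E = A (+) B of a q-matroid is expressed without projections:
   every V contains enough of some P + Q, with P <= A and Q <= B, for
   rho P + rho Q + dim V <= rho V + dim (V :&: (P + Q)).  Ranks are then additive
   across A and B, so rho P = rho (P + A) - rho A for P <= B, and two complements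
   of the same summand A are equivalent through the projection along A.
   Uniqueness therefore reduces to an exchange step: given two decompositions
   into irreducibles, some summand A of one and B of the other share a complement
   or coincide.  An irreducible summand of dimension 1 is a loop or a coloop, which
   splits off with any suitable complement.  If all summands have dimension at
   least 2 there are neither loops nor coloops, every summand is a cyclic flat, and
   cyclic flats are compatible with all decompositions, so that A lies in a summand
   B of the other family and, symmetrically, A = B. *)

Set Implicit Arguments. Unset Strict Implicit. Unset Printing Implicit Defensive.
Import GRing.Theory.
Local Open Scope ring_scope.

(** With [X = V :&: (P + Q)] this says that the minimum in the direct sum formula is attained,
    without subtraction. [V] ranges over [A + B] only, so the predicate concerns the restriction of
    [rho] to [A + B]. *)
Definition splits (F : finFieldType) (E : vectType F) (rho : {vspace E} -> nat)
    (A B : {vspace E}) : Prop :=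
  (A :&: B = 0)%VS /\
  forall V : {vspace E}, (V <= A + B)%VS ->
    exists P Q : {vspace E}, [/\ (P <= A)%VS, (Q <= B)%VS &
      (rho P + rho Q + \dim V <= rho V + \dim (V :&: (P + Q)))%N].

(** * Subspaces and projections of a direct sum decomposition *)

Section Subspaces.
Variables (K : fieldType) (E : vectType K).
Implicit Types A B P Q U V X : {vspace E}.

Lemma cap_direct A B P Q P' Q' : (A :&: B = 0)%VS ->
  (P <= A)%VS -> (P' <= A)%VS -> (Q <= B)%VS -> (Q' <= B)%VS ->
  ((P + Q) :&: (P' + Q') = P :&: P' + Q :&: Q')%VS.
Proof.
move=> AB0 sP sP' sQ sQ'; apply/eqP; rewrite eqEsubv; apply/andP; split; last first.
  by rewrite subv_cap !addvS ?capvSl ?capvSr.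
apply/subvP => x /memv_capP[/memv_addP[p Pp [q Qq ->]]].
case/memv_addP=> p' Pp' [q' Qq' e].
have pp : p - p' = q' - q by rewrite -(addrK q p) e addrAC (addrC p') addrK.
have z : p - p' = 0.
  apply/eqP; rewrite -memv0 -AB0 memv_cap {2}pp !memvB //;
  by [apply: (subvP sP)|apply: (subvP sP')|apply: (subvP sQ')|apply: (subvP sQ)].
have ep : p = p' by apply/eqP; rewrite -subr_eq0 z.
have eq : q' = q by apply/eqP; rewrite -subr_eq0 -pp z.
by apply: memv_add; rewrite memv_cap ?Pp ?Qq /= ?ep // -?eq.
Qed.

Lemma capv_diffr U V : (U :&: (V :\: U) = 0)%VS.
Proof. by rewrite capvC capv_diff. Qed.

Lemma addv_diffr U V : (U <= V)%VS -> (U + (V :\: U) = V)%VS.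
Proof. by move=> s; rewrite addvC addv_diff (addv_idPl s). Qed.

Lemma vline_pick A : A <> 0%VS ->
  exists L, [/\ (L <= A)%VS, \dim L = 1%N & L <> 0%VS].
Proof.
move/eqP=> A0; have p0 : vpick A != 0 by rewrite vpick0.
exists <[vpick A]>%VS; rewrite -memvE memv_pick dim_vline p0; split=> //.
by move/eqP; rewrite -dimv_eq0 dim_vline p0.
Qed.

Lemma daddv_pi_eq0 A B x : (A :&: B = 0)%VS -> x \in B -> daddv_pi A B x = 0.
Proof.
move=> AB0 Bx; have := daddv_pi_add AB0 (subvP (addvSr A B) x Bx).
by rewrite (@daddv_pi_id _ _ B A) // 1?capvC // -[RHS]add0r => /addIr.
Qed.

Lemma limg_daddv_pi A B P Q X : (A :&: B = 0)%VS -> (P <= A)%VS -> (Q <= B)%VS ->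
  (X <= P + Q)%VS -> (daddv_pi A B @: X <= P)%VS.
Proof.
move=> AB0 sPA sQB sX; apply/subvP => _ /memv_imgP[x /(subvP sX) + ->].
case/memv_addP=> p Pp [q Qq ->].
by rewrite linearD /= daddv_pi_id ?(subvP sPA) // daddv_pi_eq0 ?addr0 // (subvP sQB).
Qed.

Lemma sub_daddv_pi A B X : (A :&: B = 0)%VS -> (X <= A + B)%VS ->
  (X <= daddv_pi A B @: X + daddv_pi B A @: X)%VS.
Proof.
move=> AB0 sX; apply/subvP => x Xx.
by rewrite -[x](daddv_pi_add AB0) ?(subvP sX) // memv_add ?memv_img.
Qed.

End Subspaces.

(** * Decompositions inside a fixed q-matroid *)

Section Rank.
Variables (F : finFieldType) (E : vectType F) (rho : {vspace E} -> nat).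
Hypothesis qmat_rho : qmatroid_on fullv rho.
Implicit Types A B C L P Q U V W X Y Z : {vspace E}.

Lemma rank_le_dim V : (rho V <= \dim V)%N.
Proof. by case: qmat_rho => h _ _; apply: h; rewrite subvf. Qed.

Lemma rank_mono V U : (V <= U)%VS -> (rho V <= rho U)%N.
Proof. by case: qmat_rho => _ h _ sVU; apply: h; rewrite ?subvf. Qed.

Lemma rank_submod V U : (rho (V + U)%VS + rho (V :&: U)%VS <= rho V + rho U)%N.
Proof. by case: qmat_rho => _ _ h; apply: h; rewrite subvf. Qed.

Lemma rank0 : rho 0%VS = 0%N.
Proof. by have := rank_le_dim 0; rewrite dimv0 leqn0 => /eqP. Qed.

Lemma rank_add V U : (rho (V + U)%VS <= rho V + rho U)%N.
Proof. exact: leq_trans (leq_addr _ _) (rank_submod V U). Qed.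

(** Nullity, [\dim] minus [rho], is monotone: a complement of [X] in [V] adds at most its dimension
    to the rank. *)
Lemma rank_unit X V : (X <= V)%VS -> (rho V + \dim X <= rho X + \dim V)%N.
Proof.
move=> sXV; have := rank_add (V :\: X) X; rewrite addv_diff (addv_idPl sXV).
have := rank_le_dim (V :\: X); have := dimv_cap_compl V X.
rewrite (capv_idPr sXV); lia.
Qed.

Lemma splits_sym A B : splits rho A B -> splits rho B A.
Proof.
case=> AB0 h; split; first by rewrite capvC.
move=> V; rewrite addvC => /h[P [Q [sPA sQB le]]]; exists Q, P.
by split=> //; rewrite (addvC Q) (addnC (rho Q)).
Qed.

Lemma splits0 A : splits rho A 0.
Proof.
split=> [|V]; first exact: capv0.
rewrite addv0 => sVA; exists V, 0%VS; rewrite sVA subvv addv0 capvv rank0.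
by split=> //; lia.
Qed.

(** The witnesses [P'], [Q'] for [P + Q] meet it in [P :&: P' + Q :&: Q']; monotonicity of rank and
    of nullity then bounds [rho P + rho Q]. *)
Lemma splits_rank_add A B P Q : splits rho A B -> (P <= A)%VS -> (Q <= B)%VS ->
  rho (P + Q)%VS = (rho P + rho Q)%N.
Proof.
case=> AB0 h sPA sQB; have [P' [Q' [sP' sQ' le]]] := h _ (addvS sPA sQB).
apply/eqP; rewrite eqn_leq rank_add /=.
have disj U V : (U <= A)%VS -> (V <= B)%VS -> (U :&: V = 0)%VS.
  by move=> sU sV; apply/eqP; rewrite -subv0 -AB0 capvS.
move: le; rewrite (cap_direct AB0) // (dimv_disjoint_sum (disj _ _ sPA sQB)).
rewrite dimv_disjoint_sum; last by apply: disj; rewrite (subv_trans (capvSl _ _)).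
have := rank_unit (capvSl P P'); have := rank_unit (capvSl Q Q').
have := rank_mono (capvSr P P'); have := rank_mono (capvSr Q Q').
lia.
Qed.

(** The witnesses are cut down to [A0] and [B0]. Ranks can only drop, and no part of [V :&: (P + Q)]
    is lost, since [A0 + B0] meets [P + Q] componentwise. *)
Lemma splits_sub A B A0 B0 : splits rho A B -> (A0 <= A)%VS -> (B0 <= B)%VS ->
  splits rho A0 B0.
Proof.
case=> AB0 h sA sB; split; first by apply/eqP; rewrite -subv0 -AB0 capvS.
move=> V sV; have [P [Q [sP sQ le]]] := h V (subv_trans sV (addvS sA sB)).
exists (P :&: A0)%VS, (Q :&: B0)%VS; rewrite !capvSr; split=> //.
suff sub : (V :&: (P + Q) <= V :&: (P :&: A0 + Q :&: B0))%VS.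
  have := dimvS sub; have := rank_mono (capvSl P A0).
  have := rank_mono (capvSl Q B0); lia.
rewrite subv_cap capvSl -(cap_direct AB0) //.
by rewrite subv_cap capvSr (subv_trans (capvSl _ _) sV).
Qed.

Lemma splits_assoc A B C : splits rho A (B + C) -> splits rho B C ->
  splits rho (A + B) C.
Proof.
case=> A0 hA [B0 hB]; split.
  apply/eqP; rewrite -subv0; apply/subvP => x /memv_capP[].
  case/memv_addP=> a Aa [b Bb ->] Cx.
  have a0 : a = 0.
    apply/eqP; rewrite -memv0 -A0 memv_cap Aa /=.
    rewrite -(addrK b a) addrC; apply: memv_add => //; rewrite ?memvN //.
  by move: Cx; rewrite a0 add0r -B0 memv_cap Bb.
move=> V; rewrite -addvA => /hA[P [Q [sP sQ le]]].
have [R [S [sR sS le']]] := hB Q sQ.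
exists (P + R)%VS, S; rewrite addvS //; split=> //.
have disj U : (U <= B + C)%VS -> (P :&: U = 0)%VS.
  by move=> sU; apply/eqP; rewrite -subv0 -A0 capvS.
set T := (R + S)%VS in le'.
have sT : (T <= B + C)%VS by apply: addvS.
have : (V :&: (P + Q :&: T) <= V :&: (P + R + S))%VS.
  by rewrite capvS // -addvA addvS // capvSr.
move/dimvS.
have dQT : \dim (P + Q :&: T) = (\dim P + \dim (Q :&: T))%N.
  by rewrite dimv_disjoint_sum // disj // (subv_trans (capvSl _ _)).
have dQ : \dim (P + Q) = (\dim P + \dim Q)%N by rewrite dimv_disjoint_sum // disj.
(* Passing from [Q] to [Q :&: T] costs [V :&: (P + Q)] at most [\dim Q - \dim (Q :&: T)] dimensions,
   which [le'] compensates. *)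
have s1 : (P + Q :&: T <= P + Q)%VS by rewrite addvS // capvSl.
have := dimv_sum_cap (V :&: (P + Q)) (P + Q :&: T).
rewrite -capvA (capv_idPr s1).
have /dimvS : (V :&: (P + Q) + (P + Q :&: T) <= P + Q)%VS by rewrite subv_add capvSr.
have := rank_add P R; lia.
Qed.

(** The witnesses are all of [L], which costs no rank, and the part of [V + L] in [C]; by the
    modular law their sum contains [V]. *)
Lemma splits_loop L C : rho L = 0%N -> (L :&: C = 0)%VS -> splits rho L C.
Proof.
move=> L0 LC0; split=> // V sV; exists L, ((V + L) :&: C)%VS.
rewrite subvv capvSr; split=> //.
have -> : (V :&: (L + (V + L) :&: C) = V)%VS.
  apply/capv_idPl; rewrite capvC vspace_modl ?addvSr // subv_cap sV.
  exact: addvSl.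
have := rank_mono (capvSl (V + L) C); have := rank_add V L; lia.
Qed.

(* For [\dim Y = 1] this splits off a coloop. *)
Lemma splits_coloop X Y : (X :&: Y = 0)%VS ->
  (rho X + \dim (X + Y) <= rho (X + Y)%VS + \dim X)%N -> splits rho X Y.
Proof.
move=> XY0 le; split=> // V sV; exists (V :&: X)%VS, 0%VS.
rewrite capvSr sub0v addv0 rank0; split=> //.
have s : (V + X <= X + Y)%VS by rewrite subv_add sV addvSl.
rewrite (capv_idPr (capvSl V X)).
have := rank_unit s; have := rank_submod V X; have := dimv_sum_cap V X; lia.
Qed.

Definition irr_space A : Prop :=
  A <> 0%VS /\
  forall B C, splits rho B C -> (B + C)%VS = A -> B = 0%VS \/ C = 0%VS.

(** A line in [Z] would split off from [A] by [splits_loop]; irreducibility would make [A] that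
    line. *)
Lemma irr_space_loopless A Z : irr_space A -> \dim A <> 1%N ->
  (Z <= A)%VS -> rho Z = 0%N -> Z = 0%VS.
Proof.
move=> [_ irr] dA sZ Z0; have [//|nZ] := pselect (Z = 0%VS).
have [L [sL dL nL]] := vline_pick nZ.
have sLA := subv_trans sL sZ.
have L0 : rho L = 0%N by have := rank_mono sL; lia.
case: (irr _ _ (splits_loop L0 (capv_diffr L A)) (addv_diffr sLA)) => // h.
by have := addv_diffr sLA; rewrite h addv0 => e; case: dA; rewrite -e.
Qed.

(** The inequality says that [X] carries the whole nullity of [A], so [splits_coloop] splits off any
    complement of [X] in [A]. *)
Lemma irr_space_coloopless A X : irr_space A -> \dim A <> 1%N ->
  (X <= A)%VS -> (rho X + \dim A <= rho A + \dim X)%N -> X = A.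
Proof.
move=> [nA irr] dA.
have main Y : Y <> 0%VS -> (Y <= A)%VS -> (rho Y + \dim A <= rho A + \dim Y)%N -> Y = A.
  move=> nY sY le.
  have sp : splits rho Y (A :\: Y).
    by apply: splits_coloop; rewrite ?capv_diffr ?addv_diffr.
  case: (irr _ _ sp (addv_diffr sY)) => // h.
  by have := addv_diffr sY; rewrite h addv0.
have [->|nX] := pselect (X = 0%VS); last exact: main.
(* For [X = 0] the nullity of [A] is zero, so a line [L] in [A] satisfies the same inequality and
   would equal [A]. *)
rewrite rank0 dimv0 => _ le; have [L [sL dL nL]] := vline_pick nA.
case: dA; rewrite -dL; congr (\dim _); symmetry; apply: main => //.
have := rank_le_dim L; lia.
Qed.

(** Each member is split from the sum of its successors only, which suits induction; [dec_seq_rem]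
    shows that the order is immaterial. *)
Fixpoint dec_seq (s : seq {vspace E}) : Prop :=
  if s is A :: s' then splits rho A (\sum_(B <- s') B)%VS /\ dec_seq s' else True.

Lemma sum_rem A (s : seq {vspace E}) : A \in s ->
  (\sum_(B <- s) B = A + \sum_(B <- rem A s) B)%VS.
Proof. by move=> As; rewrite (perm_big _ (perm_to_rem As)) big_cons. Qed.

Lemma dec_seq_rem A (s : seq {vspace E}) : dec_seq s -> A \in s ->
  splits rho A (\sum_(B <- rem A s) B)%VS /\ dec_seq (rem A s).
Proof.
elim: s => // B s IHs [sp ds]; rewrite inE /= eq_sym.
have [eBA _|nAB /= As] := eqVneq B A; first by rewrite -eBA.
have [sA dA] := IHs ds As.
rewrite big_cons /=; split; last first.
  by split=> //; apply: splits_sub sp _ _ => //; rewrite (sum_rem As) addvSr.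
apply: splits_sym; apply: splits_assoc; last exact: splits_sym.
by rewrite addvC -sum_rem.
Qed.

Lemma dec_seq_cat s t : dec_seq s -> dec_seq t ->
  splits rho (\sum_(A <- s) A)%VS (\sum_(A <- t) A)%VS -> dec_seq (s ++ t).
Proof.
elim: s => //= A s IHs [sp ds] dt; rewrite big_cons => st.
have st' := splits_sub st (addvSr _ _) (subvv _).
split; last by apply: IHs.
rewrite big_cat /= addvC; apply: splits_sym.
apply: splits_assoc; last exact: splits_sym.
by apply: splits_sym; rewrite addvC.
Qed.

(** Used contrapositively: a nonzero [X] escapes the sum that omits some member. Once [X] lies in
    the tail sum, the modular law removes the head from every other such sum. *)
Lemma dec_seq_cap0 s X : dec_seq s -> 0%VS \notin s -> (X <= \sum_(B <- s) B)%VS ->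
  (forall B, B \in s -> X <= \sum_(C <- rem B s) C)%VS -> X = 0%VS.
Proof.
elim: s => [|A s IHs] /=; first by rewrite big_nil subv0 => _ _ /eqP.
rewrite inE negb_or => -[sp ds] /andP[A0 s0] _ h.
have sX : (X <= \sum_(B <- s) B)%VS by have := h A; rewrite mem_head eqxx; apply.
apply: IHs => // B sB; have := h B; rewrite inE sB orbT => /(_ isT).
(* [rem] deletes one occurrence, so a copy of the head in the tail is treated apart: it would lie in
   the tail sum and hence be zero. *)
have [eAB _|nAB] := eqVneq A B.
  have sA : (A <= \sum_(C <- s) C)%VS by rewrite eAB (sum_rem sB) addvSl.
  by case/eqP: A0; rewrite -sp.1 (capv_idPl sA).
rewrite big_cons => sX'.
have sR : (\sum_(C <- rem B s) C <= \sum_(C <- s) C)%VS by rewrite (sum_rem sB) addvSr.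
have eR := vspace_modl A sR; rewrite sp.1 addv0 in eR.
by rewrite eR subv_cap addvC sX'.
Qed.

(* [A] has no coloops and [A'] no loops, so [A] is a cyclic flat of [A + A'], and
   cyclic flats are compatible with every decomposition. *)
Lemma irr_space_sub A A' B B' : splits rho A A' -> splits rho B B' ->
  (A + A' = B + B')%VS -> irr_space A -> \dim A <> 1%N ->
  (forall Z, (Z <= A')%VS -> rho Z = 0%N -> Z = 0%VS) ->
  (A <= B)%VS \/ (A <= B')%VS.
Proof.
move=> sAA' sBB' eqE irrA dA loopless.
have sA : (A <= B + B')%VS by rewrite -eqE addvSl.
have [P [Q [sP sQ le]]] := sBB'.2 A sA.
have sAPQ : (A <= P + Q)%VS.
  apply/capv_idPl; apply: (irr_space_coloopless irrA) => //; first exact: capvSl.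
  have := rank_mono (capvSr A (P + Q)); have := rank_add P Q; lia.
have sPQ : (P + Q <= A + A')%VS by rewrite eqE addvS.
have ePQ : (P + Q = A + A' :&: (P + Q))%VS.
  by rewrite vspace_modl // (capv_idPr sPQ).
have : rho (P + Q)%VS = (rho A + rho (A' :&: (P + Q))%VS)%N.
  by rewrite {1}ePQ; apply: (splits_rank_add sAA'); rewrite ?capvSl.
(* Now [P + Q] contains [A] and has rank at most [rho A], so by additivity its part in [A'] has rank
   zero. Thus [A = P + Q], and irreducibility kills [P] or [Q]. *)
rewrite (capv_idPl sAPQ) in le; have := rank_add P Q => le' e.
have z : (A' :&: (P + Q) = 0)%VS by apply: loopless; [exact: capvSl|lia].
rewrite z addv0 in ePQ.
case: (irrA.2 _ _ (splits_sub sBB' sP sQ) ePQ) => h; rewrite h ?add0v ?addv0 in ePQ.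
  by right; rewrite -ePQ.
by left; rewrite -ePQ.
Qed.

End Rank.

(** * Rank-preserving linear maps *)

Section LinearMaps.
Variables (K : fieldType) (E E' : vectType K) (f : 'Hom(E, E')).
Implicit Types (A P U V X : {vspace E}) (W : {vspace E'}).

Lemma limg_sub_lift U W : (W <= f @: U)%VS ->
  exists2 V, (V <= U)%VS & (f @: V = W)%VS.
Proof.
move=> /subvP sW; exists (U :&: f @^-1: W)%VS; first exact: capvSl.
apply/vspaceP => y; apply/memv_imgP/idP => [[x /memv_capP[_ Wx] ->]|Wy].
  by rewrite memv_preim.
have /memv_imgP[x Ux e] := sW y Wy.
by exists x => //; rewrite memv_cap Ux -memv_preim -e.
Qed.

Lemma limg_dim_le U V : (U <= V)%VS ->
  (\dim (f @: V) + \dim U <= \dim (f @: U) + \dim V)%N.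
Proof.
move=> sUV; have := limg_ker_dim f U; have := limg_ker_dim f V.
have := dimvS (capvS sUV (subvv (lker f))); lia.
Qed.

Lemma capv_lkerP A : (A :&: lker f = 0)%VS <-> {in A &, injective f}.
Proof.
split=> [A0 x y Ax Ay e|inj].
  apply/eqP; rewrite -subr_eq0 -memv0 -A0 memv_cap memvB //= memv_ker.
  by rewrite linearB /= e subrr.
apply/eqP; rewrite -subv0; apply/subvP => x /memv_capP[Ax].
rewrite memv_ker memv0 => /eqP fx; apply/eqP; apply: inj; rewrite ?mem0v //.
by rewrite fx linear0.
Qed.

Lemma limg_inv A : (A :&: lker f = 0)%VS ->
  exists g : 'Hom(E', E), {in A, cancel f g}.
Proof.
(* [f] is injective on [A] only; precomposing with [projv A] lets any preimage chosen by [h^-1] be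
   projected back to the right vector of [A]. *)
move/capv_lkerP => inj; pose h := (f \o projv A)%VF.
exists (projv A \o h^-1)%VF => x Ax.
apply: inj; rewrite ?comp_lfunE ?memv_proj //.
have hE y : h y = f (projv A y) by rewrite comp_lfunE.
have e : f x = h x by rewrite hE projv_id.
by rewrite -hE e limg_lfunVK // memv_img ?memvf.
Qed.

Lemma limg_cancel (g : 'Hom(E', E)) P : {in P, cancel f g} -> (g @: (f @: P) = P)%VS.
Proof.
move=> K1; rewrite -limg_comp -[RHS]lim1g; apply: eq_in_limg => x Px.
by rewrite comp_lfunE id_lfunE K1.
Qed.

End LinearMaps.

Definition rank_isometry (F : finFieldType) (E E' : vectType F)
    (rho : {vspace E} -> nat) (rho' : {vspace E'} -> nat)
    (f : 'Hom(E, E')) (A : {vspace E}) : Prop :=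
  (A :&: lker f = 0)%VS /\
  forall P : {vspace E}, (P <= A)%VS -> rho' (f @: P)%VS = rho P.

(** Equivalence of the restrictions to [A] and [A']: the map is total but constrained on [A] alone.
    On full spaces it is [qequiv], by [qequivP]. *)
Definition isometric (F : finFieldType) (E E' : vectType F)
    (rho : {vspace E} -> nat) (A : {vspace E})
    (rho' : {vspace E'} -> nat) (A' : {vspace E'}) : Prop :=
  exists2 f : 'Hom(E, E'), rank_isometry rho rho' f A & (f @: A = A')%VS.

Section Isometry.
Variables (F : finFieldType) (E E' : vectType F).
Variables (rho : {vspace E} -> nat) (rho' : {vspace E'} -> nat).
Variables (f : 'Hom(E, E')) (A : {vspace E}).
Hypothesis isof : rank_isometry rho rho' f A.
Implicit Types B C P : {vspace E}.

Lemma isometry_dim P : (P <= A)%VS -> \dim (f @: P) = \dim P.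
Proof.
move=> sP; apply: limg_dim_eq; apply/eqP; rewrite -subv0 -isof.1.
by rewrite capvS.
Qed.

Lemma isometry_inv : exists2 g : 'Hom(E', E),
  rank_isometry rho' rho g (f @: A)%VS & {in A, cancel f g}.
Proof.
have [A0 frk] := isof; have [g fK] := limg_inv A0; exists g => //.
split.
  apply/capv_lkerP => _ _ /memv_imgP[x Ax ->] /memv_imgP[y Ay ->].
  by rewrite !fK // => ->.
move=> W /limg_sub_lift[V sV <-]; rewrite frk // limg_cancel //.
by move=> x /(subvP sV); apply: fK.
Qed.

Lemma isometry_restrict B : (B <= A)%VS -> isometric rho B rho' (f @: B)%VS.
Proof.
move=> sB; exists f => //; split=> [|P sP]; last by apply: isof.2; apply: subv_trans sB.
by apply/eqP; rewrite -subv0 -isof.1 capvS.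
Qed.

Lemma isometry_splits B C : (B + C <= A)%VS -> splits rho B C ->
  splits rho' (f @: B)%VS (f @: C)%VS.
Proof.
move=> sBC [BC0 h]; have /andP[sB sC] : (B <= A)%VS && (C <= A)%VS.
  by rewrite -subv_add.
split.
  have := dimv_sum_cap (f @: B) (f @: C); rewrite -limgD !isometry_dim //.
  rewrite dimv_disjoint_sum // -[RHS]addn0 => /addnI/eqP.
  by rewrite dimv_eq0 => /eqP.
move=> W; rewrite -limgD => /limg_sub_lift[V sV <-].
have [P [Q [sP sQ le]]] := h V sV.
exists (f @: P)%VS, (f @: Q)%VS; rewrite !limgS //; split=> //.
have sVA := subv_trans sV sBC.
rewrite !isof.2 ?(subv_trans sP) ?(subv_trans sQ) // isometry_dim //.
have := dimvS (limg_cap f V (P + Q)).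
rewrite isometry_dim ?(subv_trans (capvSl _ _)) // limgD; lia.
Qed.

Lemma isometry_dec_seq s : (\sum_(B <- s) B <= A)%VS -> dec_seq rho s ->
  dec_seq rho' [seq (f @: B)%VS | B <- s].
Proof.
elim: s => //= B s IHs; rewrite big_cons => sA [sp ds]; split.
  by rewrite big_map -limg_sum; apply: isometry_splits.
by apply: IHs => //; apply: subv_trans sA; apply: addvSr.
Qed.

End Isometry.

Section Isometric.
Variable F : finFieldType.

Lemma isometric_refl (E : vectType F) rho (A : {vspace E}) : isometric rho A rho A.
Proof.
exists \1%VF; last exact: lim1g.
by split=> [|P _]; [apply/capv_lkerP => x y _ _; rewrite !id_lfunE|rewrite lim1g].
Qed.

Lemma isometric_sym (E E' : vectType F) rho (A : {vspace E}) rho' (A' : {vspace E'}) :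
  isometric rho A rho' A' -> isometric rho' A' rho A.
Proof.
case=> f isof <-; have [g isog fK] := isometry_inv isof.
by exists g => //; apply: limg_cancel.
Qed.

Lemma isometric_trans (E1 E2 E3 : vectType F) rho1 (A1 : {vspace E1})
    rho2 (A2 : {vspace E2}) rho3 (A3 : {vspace E3}) :
  isometric rho1 A1 rho2 A2 -> isometric rho2 A2 rho3 A3 ->
  isometric rho1 A1 rho3 A3.
Proof.
case=> f [/capv_lkerP injf frk] <- [g [/capv_lkerP injg grk] <-].
exists (g \o f)%VF; last exact: limg_comp.
split.
  apply/capv_lkerP => x y Ax Ay; rewrite !comp_lfunE => e.
  by apply: injf => //; apply: injg => //; apply: memv_img.
by move=> P sP; rewrite limg_comp grk ?limgS // frk.
Qed.

Lemma isometric_irr (E E' : vectType F) rho (A : {vspace E}) rho' (A' : {vspace E'}) :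
  isometric rho A rho' A' -> irr_space rho A -> irr_space rho' A'.
Proof.
move=> iso [nA irr]; have [f isof fA] := isometric_sym iso; split=> [A'0|B C sp e].
  by apply: nA; rewrite -fA A'0 limg0.
have /andP[sB sC] : (B <= A')%VS && (C <= A')%VS by rewrite -subv_add e.
have := irr _ _ (isometry_splits isof _ sp); rewrite e subvv -limgD e fA.
move/(_ isT erefl) => [] /eqP; rewrite -dimv_eq0 (isometry_dim isof) // dimv_eq0 => /eqP;
  by [left|right].
Qed.

(* The universal property of direct sums with respect to weak maps. *)
Lemma splits_rank_le (E E' : vectType F) rho rho' (f : 'Hom(E, E')) (A B : {vspace E}) :
  qmatroid_on fullv rho' -> splits rho A B ->
  (forall P, (P <= A)%VS -> rho' (f @: P)%VS <= rho P)%N ->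
  (forall P, (P <= B)%VS -> rho' (f @: P)%VS <= rho P)%N ->
  forall V, (V <= A + B)%VS -> (rho' (f @: V)%VS <= rho V)%N.
Proof.
move=> qm' [_ h] hA hB V sV; have [P [Q [sP sQ le]]] := h V sV.
have := rank_unit qm' (limgS f (capvSl V (P + Q))).
have := rank_mono qm' (limgS f (capvSr V (P + Q))).
have := limg_dim_le f (capvSl V (P + Q)).
rewrite limgD; have := rank_add qm' (f @: P) (f @: Q).
have := hA P sP; have := hB Q sQ; lia.
Qed.

(** The two maps are glued through the projections. The glued map and its inverse are both weak maps
    by [splits_rank_le], so ranks agree. *)
Lemma isometric_add (E E' : vectType F) rho (A B : {vspace E}) rho' (A' B' : {vspace E'}) :
  qmatroid_on fullv rho -> qmatroid_on fullv rho' ->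
  splits rho A B -> splits rho' A' B' ->
  isometric rho A rho' A' -> isometric rho B rho' B' ->
  isometric rho (A + B)%VS rho' (A' + B')%VS.
Proof.
move=> qm qm' sp sp' [f1 iso1 e1] [f2 iso2 e2].
pose f := ((f1 \o daddv_pi A B) + (f2 \o daddv_pi B A))%VF.
have fE x : f x = f1 (daddv_pi A B x) + f2 (daddv_pi B A x).
  by rewrite /f add_lfunE !comp_lfunE.
have AB0 := sp.1; have BA0 := AB0; rewrite capvC in BA0.
have fA P : (P <= A)%VS -> (f @: P = f1 @: P)%VS.
  move=> sP; apply: eq_in_limg => x /(subvP sP) Ax.
  by rewrite fE (daddv_pi_id AB0) // (daddv_pi_eq0 BA0) // linear0 addr0.
have fB P : (P <= B)%VS -> (f @: P = f2 @: P)%VS.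
  move=> sP; apply: eq_in_limg => x /(subvP sP) Bx.
  by rewrite fE (daddv_pi_id BA0) // (daddv_pi_eq0 AB0) // linear0 add0r.
have fAB : (f @: (A + B) = A' + B')%VS by rewrite limgD fA // fB // e1 e2.
have inj : ((A + B) :&: lker f = 0)%VS.
  apply/eqP; rewrite -dimv_eq0; have := limg_ker_dim f (A + B); rewrite fAB.
  rewrite (dimv_disjoint_sum sp'.1) (dimv_disjoint_sum AB0) -e1 -e2.
  rewrite (isometry_dim iso1) // (isometry_dim iso2) //; lia.
have [g fK] := limg_inv inj.
have gK V : (V <= A + B)%VS -> (g @: (f @: V) = V)%VS.
  by move=> sV; apply: limg_cancel => x /(subvP sV); apply: fK.
exists f => //; split=> // V sV; apply/eqP; rewrite eqn_leq; apply/andP; split.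
  apply: (splits_rank_le qm' sp) => // P sP.
    by rewrite fA // iso1.2.
  by rewrite fB // iso2.2.
rewrite -{1}(gK V sV); apply: (splits_rank_le qm sp') => [P|P|].
- rewrite -e1 => /limg_sub_lift[P0 sP <-]; rewrite -fA // gK ?fA ?iso1.2 //.
  exact: subv_trans sP (addvSl _ _).
- rewrite -e2 => /limg_sub_lift[P0 sP <-]; rewrite -fB // gK ?fB ?iso2.2 //.
  exact: subv_trans sP (addvSr _ _).
- by rewrite -fAB limgS.
Qed.

(* [B] and [C] both represent the contraction by [A]; the projection along [A]
   identifies them. *)
Lemma splits_cancel (E : vectType F) rho (A B C : {vspace E}) :
  qmatroid_on fullv rho -> splits rho A B -> splits rho A C ->
  (A + B = A + C)%VS -> isometric rho B rho C.
Proof.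
move=> qm spB spC e; pose f := daddv_pi C A.
have CA0 : (C :&: A = 0)%VS by rewrite capvC spC.1.
have piE x : x \in B -> f x = x - daddv_pi A C x.
  move=> Bx; apply: (canRL (addrK _)); apply: daddv_pi_add => //.
  by rewrite addvC -e; apply: (subvP (addvSr A B)).
have inj : (B :&: lker f = 0)%VS.
  apply/eqP; rewrite -subv0 -spB.1 subv_cap capvSl andbT.
  apply/subvP => x /memv_capP[Bx]; rewrite memv_ker piE // subr_eq0 => /eqP->.
  exact: memv_pi.
have sfC P : (f @: P <= C)%VS.
  by apply/subvP => _ /memv_imgP[x _ ->]; apply: memv_pi.
(* [f] moves each vector of [B] by an element of [A], so [P] and its image have the same sum with
   [A]; additivity then cancels [rho A]. *)
have fP P : (P <= B)%VS -> (A + f @: P = A + P)%VS.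
  move=> sP; apply/eqP; rewrite eqEsubv !subv_add !addvSl /=; apply/andP; split.
    apply/subvP => _ /memv_imgP[x Px ->]; rewrite piE ?(subvP sP) // addrC.
    by rewrite memv_add ?memvN ?memv_pi.
  apply/subvP => x Px; rewrite -(subrK (f x) x) memv_add ?memv_img //.
  by rewrite piE ?(subvP sP) // subKr memv_pi.
exists f; last first.
  apply/eqP; rewrite eqEdim sfC limg_dim_eq //.
  have := congr1 (fun U => \dim U) e.
  by rewrite /= !dimv_disjoint_sum ?spB.1 ?spC.1 // => /addnI->.
split=> // P sP; have := congr1 rho (fP P sP).
rewrite (splits_rank_add qm spC) ?subvv // (splits_rank_add qm spB) ?subvv //.
by move/addnI.
Qed.

End Isometric.

(** * Exchange and uniqueness *)

Section KrullSchmidt.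
Variables (F : finFieldType) (E : vectType F) (rho : {vspace E} -> nat).
Hypothesis qmat_rho : qmatroid_on fullv rho.
Implicit Types (A B : {vspace E}) (s t : seq {vspace E}).

Lemma irr_notin0 s : {in s, forall A, irr_space rho A} -> 0%VS \notin s.
Proof. by move=> irr; apply/negP => /irr[]. Qed.

Lemma sum_sup A s : A \in s -> (A <= \sum_(B <- s) B)%VS.
Proof. by move=> /sum_rem->; apply: addvSl. Qed.

(** The remaining sums need only be isometric, as the exchange may change the complement. Hence
    [dec_seq_unique] assumes an isometry between the sums. *)
Definition exchangeable s t := exists A B, [/\ A \in s, B \in t,
  isometric rho A rho B &
  isometric rho (\sum_(C <- rem A s) C)%VS rho (\sum_(C <- rem B t) C)%VS].

Lemma exchangeable_sym s t : exchangeable s t -> exchangeable t s.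
Proof.
by case=> A [B [sA tB i1 i2]]; exists B, A; split=> //; apply: isometric_sym.
Qed.

Lemma dim1_cap A B : \dim A = 1%N -> ~~ (A <= B)%VS -> (A :&: B = 0)%VS.
Proof.
move=> dA nAB; apply/eqP; rewrite -dimv_eq0.
have := dimv_leqif_eq (capvSl A B); rewrite dA => /ltn_leqif.
by rewrite ltnS leqn0 => ->; apply: contra nAB => /eqP/capv_idPl.
Qed.

(** Rank 1 makes [A] a coloop, rank 0 a loop. In each case the [B] found in [t] is forced to have
    dimension 1, and [splits_cancel] applies twice. *)
Lemma exchange_dim1 s t A : dec_seq rho s -> dec_seq rho t ->
  {in t, forall B, irr_space rho B} ->
  (\sum_(B <- s) B = \sum_(B <- t) B)%VS -> A \in s -> \dim A = 1%N ->
  exchangeable s t.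
Proof.
move=> ds dt irr est sA dA; have [spA _] := dec_seq_rem qmat_rho ds sA.
have eA := sum_rem sA; set A' := (\sum_(C <- rem A s) C)%VS in spA eA.
have sAt : (A <= \sum_(C <- t) C)%VS by rewrite -est sum_sup.
have nA : A <> 0%VS by move=> A0; move: dA; rewrite A0 dimv0.
have := rank_le_dim qmat_rho A; rewrite dA leq_eqVlt ltnS leqn0.
case/orP=> /eqP rA.
  (* Coloop case: the hyperplane [A'] of the total sum does not contain some [B]. It cuts [B] in a
     hyperplane of smaller rank, so [B] has a coloop, is a line, and is a second complement of
     [A']. *)
  have [B tB nB] : exists2 B, B \in t & ~~ (B <= A')%VS.
    apply: contrapT => h; apply: nA; rewrite -spA.1; apply/esym/capv_idPl.
    apply: subv_trans sAt _.
    rewrite big_seq; apply: (big_ind (fun U => (U <= A')%VS)).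
    - exact: sub0v.
    - by move=> U V sU sV; rewrite subv_add sU.
    by move=> B tB; apply: contrapT => nB; apply: h; exists B => //; exact/negP.
  have eB := sum_rem tB; have [spB _] := dec_seq_rem qmat_rho dt tB.
  have e : (A' + B = A + A')%VS.
    apply/eqP; rewrite eqEdim subv_add addvSr -eA est sum_sup //=.
    rewrite -est eA (dimv_disjoint_sum spA.1) dA add1n.
    by rewrite (ltn_leqif (dimv_leqif_sup (addvSl _ _))) subv_add subvv.
  have dX : (\dim B = (\dim (A' :&: B)).+1)%N.
    have := dimv_sum_cap A' B; rewrite e (dimv_disjoint_sum spA.1) dA; lia.
  have rX : (rho (A' :&: B)%VS < rho B)%N.
    have := rank_submod qmat_rho A' B; rewrite e.
    rewrite (splits_rank_add qmat_rho spA) // rA; lia.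
  have dB : \dim B = 1%N.
    apply: contrapT => dB; move/negP: nB; apply; apply/capv_idPr.
    by apply: (irr_space_coloopless qmat_rho (irr B tB) dB (capvSr _ _)); lia.
  have X0 : (A' :&: B = 0)%VS by apply/eqP; rewrite -dimv_eq0; lia.
  have spA'B : splits rho A' B.
    apply: splits_coloop => //; rewrite e (splits_rank_add qmat_rho spA) //.
    rewrite (dimv_disjoint_sum spA.1); lia.
  exists A, B; split=> //.
    by apply: (splits_cancel qmat_rho (splits_sym spA) spA'B); rewrite addvC.
  apply: (splits_cancel qmat_rho (splits_sym spA'B) spB).
  by rewrite addvC e -eA est eB.
(* Loop case: for some [B], the line [A] is not in the sum [C] of the other members, so
   [splits_loop] applies to [A] and [C]. *)
have [B tB nB] : exists2 B, B \in t & ~~ (A <= \sum_(C <- rem B t) C)%VS.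
  apply: contrapT => h; apply: nA.
  apply: (dec_seq_cap0 dt (irr_notin0 irr) sAt) => B tB.
  by apply: contrapT => nB; apply: h; exists B => //; exact/negP.
have eB := sum_rem tB; have [spB _] := dec_seq_rem qmat_rho dt tB.
set C := (\sum_(C <- rem B t) C)%VS in nB eB spB.
have AC0 := dim1_cap dA nB.
have spAC : splits rho A C by apply: splits_loop.
(* Splitting [A] along [B] and [C] yields a rank zero [P] in [B], nonzero since [A] is not in [C];
   so [B] is a line. *)
have [P [Q [sP sQ le]]] : exists P Q, [/\ (P <= B)%VS, (Q <= C)%VS &
    (rho P + rho Q + \dim A <= rho A + \dim (A :&: (P + Q)))%N].
  by apply: spB.2; rewrite -eB.
have sAPQ : (A <= P + Q)%VS.
  by apply/capv_idPl/eqP; rewrite eqEdim capvSl; lia.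
have rP : rho P = 0%N by move: le; rewrite (capv_idPl sAPQ); lia.
have dB : \dim B = 1%N.
  apply: contrapT => dB; move/negP: nB; apply.
  have P0 := irr_space_loopless qmat_rho (irr B tB) dB sP rP.
  by apply: subv_trans sAPQ _; rewrite P0 add0v.
have e : (A + C = B + C)%VS.
  apply/eqP; rewrite eqEdim subv_add -eB sAt eB addvSr.
  by rewrite (dimv_disjoint_sum AC0) (dimv_disjoint_sum spB.1) dA dB leqnn.
exists A, B; split=> //.
  apply: (splits_cancel qmat_rho (splits_sym spAC) (splits_sym spB)).
  by rewrite addvC e addvC.
by apply: (splits_cancel qmat_rho spA spAC); rewrite e -eB -est eA.
Qed.

(** The witnesses for a rank zero [Z] have rank zero, and their sum contains [Z]. *)
Lemma dec_seq_loopless s : dec_seq rho s ->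
  (forall A Z, A \in s -> (Z <= A)%VS -> rho Z = 0%N -> Z = 0%VS) ->
  forall Z, (Z <= \sum_(A <- s) A)%VS -> rho Z = 0%N -> Z = 0%VS.
Proof.
elim: s => [_ _ Z|A s IHs [sp ds] h Z]; first by rewrite big_nil subv0 => /eqP.
rewrite big_cons => sZ Z0; have [P [Q [sP sQ le]]] := sp.2 Z sZ.
have sZPQ : (Z <= P + Q)%VS.
  by apply/capv_idPl/eqP; rewrite eqEdim capvSl; lia.
move: le; rewrite (capv_idPl sZPQ) => le.
have P0 : P = 0%VS by apply: (h A); rewrite ?mem_head //; lia.
have Q0 : Q = 0%VS.
  by apply: IHs => // [B Y sB|]; [apply: h; rewrite inE sB orbT|lia].
by apply/eqP; rewrite -subv0 (subv_trans sZPQ) // P0 Q0 addv0.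
Qed.

(** By [irr_space_sub], [A] lies in [B] or in the sum of the other members; were it the latter for
    every [B], [dec_seq_cap0] would give [A = 0]. *)
Lemma dec_seq_irr_sub s t A : dec_seq rho s -> dec_seq rho t ->
  {in s, forall B, irr_space rho B} -> {in t, forall B, irr_space rho B} ->
  {in s, forall B, \dim B <> 1%N} ->
  (\sum_(B <- s) B = \sum_(B <- t) B)%VS -> A \in s ->
  exists2 B, B \in t & (A <= B)%VS.
Proof.
move=> ds dt irrs irrt dims est sA; have [spA dA'] := dec_seq_rem qmat_rho ds sA.
apply: contrapT => h; case: (irrs A sA) => nA _; apply: nA.
apply: (dec_seq_cap0 dt (irr_notin0 irrt)) => [|B tB].
  by rewrite -est sum_sup.
have [spB _] := dec_seq_rem qmat_rho dt tB.
case: (irr_space_sub qmat_rho spA spB) => //.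
- by rewrite -!sum_rem.
- exact: irrs.
- exact: dims.
- apply: dec_seq_loopless dA' _ => C Z /mem_rem sC.
  exact: (irr_space_loopless qmat_rho (irrs C sC) (dims C sC)).
- by move=> sAB; case: h; exists B.
Qed.

Lemma exchange s t : dec_seq rho s -> dec_seq rho t ->
  {in s, forall A, irr_space rho A} -> {in t, forall B, irr_space rho B} ->
  (\sum_(A <- s) A = \sum_(B <- t) B)%VS -> s != [::] -> exchangeable s t.
Proof.
move=> ds dt irrs irrt est s0.
have [[A sA dA]|dims] := pselect (exists2 A, A \in s & \dim A = 1%N).
  exact: exchange_dim1 dA.
have [[B tB dB]|dimt] := pselect (exists2 B, B \in t & \dim B = 1%N).
  by apply: exchangeable_sym; apply: exchange_dim1 dB.
have dims' : {in s, forall A, \dim A <> 1%N} by move=> A sA dA; apply: dims; exists A.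
have dimt' : {in t, forall B, \dim B <> 1%N} by move=> B tB dB; apply: dimt; exists B.
have [A sA] : exists A, A \in s by case: (s) s0 => // A ? _; exists A; apply: mem_head.
have [B tB sAB] := dec_seq_irr_sub ds dt irrs irrt dims' est sA.
have [C sC sBC] := dec_seq_irr_sub dt ds irrt irrs dimt' (esym est) tB.
have [spA _] := dec_seq_rem qmat_rho ds sA.
(* If [C] were another member of [s], then [A <= B <= C] would put [A] inside its own complement. *)
have eCA : C = A.
  apply: contrapT => nCA; case: (irrs A sA) => nA _; apply: nA.
  rewrite -spA.1; apply/esym/capv_idPl; apply: subv_trans sAB (subv_trans sBC _).
  apply: sum_sup; have := perm_mem (perm_to_rem sA) C; rewrite sC inE.
  by case: eqP nCA => // _ _ <-.
have eAB : A = B by apply/eqP; rewrite eqEsubv sAB -eCA.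
rewrite -{}eAB in tB; have [spA2 _] := dec_seq_rem qmat_rho dt tB.
exists A, A; split=> //; first exact: isometric_refl.
by apply: (splits_cancel qmat_rho spA spA2); rewrite -!sum_rem.
Qed.

(** Induction on a bound for [size s]: the isometry carries [s] to a list with the same sum as [t],
    one pair is exchanged, and the remaining sums are again isometric. *)
Lemma dec_seq_unique n s t : (size s <= n)%N -> dec_seq rho s -> dec_seq rho t ->
  {in s, forall A, irr_space rho A} -> {in t, forall B, irr_space rho B} ->
  isometric rho (\sum_(A <- s) A)%VS rho (\sum_(B <- t) B)%VS ->
  exists p : seq ({vspace E} * {vspace E}),
    [/\ perm_eq (unzip1 p) s, perm_eq (unzip2 p) t &
      forall x, x \in p -> isometric rho x.1 rho x.2].
Proof.
elim: n s t => [|n IHn] s t szs ds dt irrs irrt [f isof fs].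
(* An empty [s] occurs in the base case and in the induction step; then [t] is empty too, its
   members being nonzero. *)
all: have [s0|s0] := eqVneq s [::];
  first (subst s; exists [::]; split=> //;
    case: t {dt} irrt fs => // B t irrt; rewrite big_nil big_cons limg0 => e;
    case: (irrt B (mem_head _ _)) => nB _; case: nB;
    by apply/eqP; rewrite -subv0 e addvSl).
  by case: s szs s0 {ds irrs isof fs}.
pose s1 := [seq (f @: A)%VS | A <- s].
have es1 : (\sum_(A <- s1) A = \sum_(B <- t) B)%VS by rewrite big_map -limg_sum.
have isoA A := isometry_restrict isof (B := A).
have irr1 : {in s1, forall A, irr_space rho A}.
  move=> _ /mapP[A sA ->]; apply: isometric_irr (irrs A sA).
  by apply: isoA; apply: sum_sup.
have ds1 : dec_seq rho s1 by exact: (isometry_dec_seq isof (subvv _) ds).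
have s10 : s1 != [::] by rewrite -size_eq0 size_map size_eq0.
have [A1 [B [/mapP[A sA eA1] tB iAB iR]]] := exchange ds1 dt irr1 irrt es1 s10.
have s1A : A1 \in s1 by rewrite eA1 map_f.
have eR : (\sum_(C <- rem A1 s1) C = f @: (\sum_(C <- rem A s) C))%VS.
  (* Removal and image are compared up to permutation, which suffices for a sum. *)
  rewrite limg_sum -(big_map (lfun_img f) predT id); apply: perm_big.
  have pA : perm_eq s1 (A1 :: map (lfun_img f) (rem A s)).
    by rewrite eA1; apply: (perm_map (lfun_img f) (perm_to_rem sA)).
  rewrite -(perm_cons A1); apply: perm_trans pA.
  by rewrite perm_sym perm_to_rem.
have [] := IHn (rem A s) (rem B t).
- by rewrite size_rem //; case: (size s) szs.
- exact: (dec_seq_rem qmat_rho ds sA).2.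
- exact: (dec_seq_rem qmat_rho dt tB).2.
- by move=> C /mem_rem; apply: irrs.
- by move=> C /mem_rem; apply: irrt.
- by apply: isometric_trans iR; rewrite eR; apply: isoA; rewrite (sum_rem sA) addvSr.
move=> p [p1 p2 ip]; exists ((A, B) :: p); split=> /=.
- by rewrite perm_sym (perm_trans (perm_to_rem sA)) // perm_cons perm_sym.
- by rewrite perm_sym (perm_trans (perm_to_rem tB)) // perm_cons perm_sym.
move=> x; rewrite inE => /orP[/eqP->|/ip//] /=.
by apply: isometric_trans iAB; rewrite eA1; apply: isoA; apply: sum_sup.
Qed.

Lemma irr_dec_exists A : exists s, [/\ dec_seq rho s,
  {in s, forall B, irr_space rho B} & (\sum_(B <- s) B = A)%VS].
Proof.
move: {2}(\dim A).+1 (ltnSn (\dim A)) => n; elim: n A => // n IHn A dA.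
have [A0|nA] := pselect (A = 0%VS); first by exists [::]; split=> //; rewrite big_nil.
have [irrA|] := pselect (irr_space rho A).
  exists [:: A]; split=> /=; last by rewrite big_seq1.
    by rewrite big_nil; split=> //; apply: splits0.
  by move=> B; rewrite inE => /eqP->.
move=> red; have [B [C [sp eBC nB nC]]] : exists B C,
    [/\ splits rho B C, (B + C = A)%VS, B <> 0%VS & C <> 0%VS].
  apply: contrapT => h; apply: red; split=> // B C sp e.
  have [|nB] := pselect (B = 0%VS); first by left.
  by right; apply: contrapT => nC; apply: h; exists B, C.
have dE := dimv_disjoint_sum sp.1; rewrite eBC in dE.
move/eqP: nB; rewrite -dimv_eq0 => nB; move/eqP: nC; rewrite -dimv_eq0 => nC.
have [|s [ds irrs es]] := IHn B; first by lia.
have [|t [dt irrt et]] := IHn C; first by lia.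
exists (s ++ t); split; last by rewrite big_cat /= es et.
  by apply: dec_seq_cat; rewrite ?es ?et.
by move=> D; rewrite mem_cat => /orP[/irrs|/irrt].
Qed.

End KrullSchmidt.

(** * External direct sums *)

Section Transport.
Variable F : finFieldType.
Implicit Types (E : vectType F) (M N : qmat F) (Ms Ns : seq (qmat F)).

Lemma minsub_le E (V X : {vspace E}) f : (X <= V)%VS -> (minsub V f <= f X)%N.
Proof.
by move=> sX; rewrite /minsub; case: ex_minnP => n _; apply; apply/asboolP; exists X.
Qed.

Lemma minsub_attained E (V : {vspace E}) f : exists2 X, (X <= V)%VS & f X = minsub V f.
Proof. by rewrite /minsub; case: ex_minnP => n /asboolP. Qed.

Lemma qequivP M N : qequiv M N <-> isometric (qm_rho (q:=M)) fullv (qm_rho (q:=N)) fullv.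
Proof.
split=> [[f [[g fK gK] frk]]|[f [/capv_lkerP inj frk] fE]].
  exists f; last first.
    apply/vspaceP => y; rewrite memvf; apply/memv_imgP.
    by exists (g y); rewrite ?memvf ?gK.
  by split=> [|P _]; [apply/capv_lkerP => x y _ _; apply: (can_inj fK)|apply: frk].
have [g fK] := limg_inv ((capv_lkerP _ _).2 inj).
exists f; split=> [|V]; last by apply: frk; apply: subvf.
exists g => [x|y]; first by apply: fK; rewrite memvf.
have : y \in (f @: fullv)%VS by rewrite fE memvf.
by case/memv_imgP=> x _ ->; rewrite fK ?memvf.
Qed.

(** [reducible] allows any rank functions on the summands, whereas [splits] uses the rank of [M]
    itself. *)
Lemma reducibleP M : is_qmatroid M ->
  reducible M <-> exists E1 E2 : {vspace qm_E M},
    [/\ E1 <> 0%VS, E2 <> 0%VS, (E1 + E2 = fullv)%VS & splits (@qm_rho F M) E1 E2].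
Proof.
move=> qm; split.
  case=> E1 [E2 [r1 [r2 [[/eqP n1 /eqP n2 E0 E12] [qm1 [qm2 h]]]]]].
  exists E1, E2; split=> //; split=> // V _.
  have [X sX eX] := minsub_attained V (fun X => r1 (daddv_pi E1 E2 @: X)%VS
     + r2 (daddv_pi E2 E1 @: X)%VS + \dim V - \dim X)%N.
  have E0' := E0; rewrite capvC in E0'.
  have r0 W r : qmatroid_on W r -> r 0%VS = 0%N.
    by case=> le _ _; have := le 0%VS (sub0v _); rewrite dimv0 leqn0 => /eqP.
  (* Testing the minimum at [X = W] bounds the rank of [M] by [r1] on [E1]; this one inequality
     suffices below. *)
  have k1 W : (W <= E1)%VS -> (qm_rho W <= r1 W)%N.
    move=> sW; rewrite h; apply: leq_trans (minsub_le _ (subvv W)) _.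
    have sW0 : (W <= W + 0)%VS by rewrite addv0.
    have s1 := limg_daddv_pi E0 sW (sub0v _) sW0; rewrite addvC in sW0.
    have := limg_daddv_pi E0' (sub0v _) sW sW0; rewrite subv0 => /eqP->.
    have [_ /(_ _ _ s1 sW) le _] := qm1.
    by rewrite (r0 _ _ _ _ qm2) addn0 addnK.
  have k2 W : (W <= E2)%VS -> (qm_rho W <= r2 W)%N.
    move=> sW; rewrite h; apply: leq_trans (minsub_le _ (subvv W)) _.
    have sW0 : (W <= W + 0)%VS by rewrite addv0.
    have s2 := limg_daddv_pi E0' sW (sub0v _) sW0; rewrite addvC in sW0.
    have := limg_daddv_pi E0 (sub0v _) sW sW0; rewrite subv0 => /eqP->.
    have [_ /(_ _ _ s2 sW) le _] := qm2.
    by rewrite (r0 _ _ _ _ qm1) add0n addnK.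
  (* The witnesses are the projections of a minimiser [X], which is contained in their sum. *)
  exists (daddv_pi E1 E2 @: X)%VS, (daddv_pi E2 E1 @: X)%VS.
  have sp (A B : {vspace qm_E M}) : (daddv_pi A B @: X <= A)%VS.
    by apply/subvP => _ /memv_imgP[x _ ->]; apply: memv_pi.
  rewrite !sp; split=> //.
  have := k1 _ (sp E1 E2); have := k2 _ (sp E2 E1).
  rewrite [X in (_ <= X + _)%N]h -eX.
  have : (X <= V :&: (daddv_pi E1 E2 @: X + daddv_pi E2 E1 @: X))%VS.
    by rewrite subv_cap sX sub_daddv_pi // E12 subvf.
  move/dimvS; have := dimvS sX; lia.
case=> E1 [E2 [/eqP n1 /eqP n2 E12 sp]].
exists E1, E2, (@qm_rho F M), (@qm_rho F M); have [m1 m2 m3] := qm.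
split; first by split=> //; apply: sp.1.
have qm_on A : qmatroid_on A (@qm_rho F M).
  split=> [V _|V U sVU _|V U _ _]; [apply: m1|apply: m2|apply: m3]; by rewrite ?subvf.
split; first exact: qm_on.
split; first exact: qm_on.
(* One inequality holds for every [X], by monotone nullity and subadditivity; the other tests the
   minimum at [V :&: (P + Q)]. *)
move=> V; apply/eqP; rewrite eqn_leq; apply/andP; split.
  have [X sX <-] := minsub_attained V (fun X => qm_rho (daddv_pi E1 E2 @: X)%VS
     + qm_rho (daddv_pi E2 E1 @: X)%VS + \dim V - \dim X)%N.
  have : (X <= daddv_pi E1 E2 @: X + daddv_pi E2 E1 @: X)%VS.
    by rewrite sub_daddv_pi ?E12 ?subvf //; apply: sp.1.
  move/(rank_mono qm); have := rank_add qm (daddv_pi E1 E2 @: X) (daddv_pi E2 E1 @: X).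
  have := rank_unit qm sX; have := dimvS sX; lia.
have [P [Q [sP sQ le]]] : exists P Q : {vspace qm_E M}, [/\ (P <= E1)%VS, (Q <= E2)%VS &
    (qm_rho P + qm_rho Q + \dim V <= qm_rho V + \dim (V :&: (P + Q)))%N].
  by apply: sp.2; rewrite E12 subvf.
apply: leq_trans (minsub_le _ (capvSl V (P + Q))) _.
have h1 := limg_daddv_pi sp.1 sP sQ (capvSr V (P + Q)).
have h2 : (daddv_pi E2 E1 @: (V :&: (P + Q)) <= Q)%VS.
  by apply: (limg_daddv_pi _ sQ sP); rewrite 1?capvC ?sp.1 // addvC capvSl.
have := rank_mono qm h1; have := rank_mono qm h2; lia.
Qed.

Lemma irr_summandP M : is_qmatroid M ->
  irr_summand M <-> irr_space (@qm_rho F M) fullv.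
Proof.
move=> qm; have fP : (0 < \dim (fullv : {vspace qm_E M}))%N <->
    fullv <> 0%VS :> {vspace qm_E M}.
  by rewrite lt0n dimv_eq0; split=> /eqP.
split=> [[_ irr /fP nE]|[nE irr]].
  split=> // B C sp e; apply: contrapT => h; apply: irr; apply/reducibleP => //.
  by exists B, C; split=> // e0; apply: h; [left|right].
split=> //; last exact/fP.
by move/(reducibleP qm) => [B [C [nB nC e sp]]]; case: (irr B C sp e).
Qed.

(** * The rank function of a direct sum given by two projections *)

Section DirectSum.
Variables (E E1 E2 : vectType F) (p1 : 'Hom(E, E1)) (p2 : 'Hom(E, E2)).
Variables (rho : {vspace E} -> nat).
Variables (rho1 : {vspace E1} -> nat) (rho2 : {vspace E2} -> nat).
Hypotheses (qm1 : qmatroid_on fullv rho1) (qm2 : qmatroid_on fullv rho2).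
Hypothesis rhoE : forall V, rho V =
  minsub V (fun X => rho1 (p1 @: X)%VS + rho2 (p2 @: X)%VS + \dim V - \dim X)%N.
(** A monotone submodular weight; [rho] is the q-analogue of the rank function of the matroid
    induced by [w]. *)
Let w (X : {vspace E}) := (rho1 (p1 @: X)%VS + rho2 (p2 @: X)%VS)%N.

Lemma dsum_rank_le V X : (X <= V)%VS -> (rho V + \dim X <= w X + \dim V)%N.
Proof.
move=> sX; have := minsub_le (fun X => w X + \dim V - \dim X)%N sX.
have := dimvS sX; rewrite rhoE /w; lia.
Qed.

Lemma dsum_rank_attained V :
  exists2 X, (X <= V)%VS & (rho V + \dim X = w X + \dim V)%N.
Proof.
have [X sX eX] := minsub_attained V (fun X => w X + \dim V - \dim X)%N.
by exists X => //; rewrite rhoE; have := dimvS sX; move: eX; rewrite /w => <-; lia.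
Qed.

(** If [X] and [Y] are minimisers for [V] and [U], then [X + Y] and [X :&: Y] compete for [V + U]
    and [V :&: U]. For monotonicity, a minimiser for the larger space is cut down to the smaller. *)
Lemma dsum_rank_qmatroid : qmatroid_on fullv rho.
Proof.
have w_mono X Y : (X <= Y)%VS -> (w X <= w Y)%N.
  by move=> sXY; rewrite leq_add ?(rank_mono qm1 (limgS _ _)) ?(rank_mono qm2 (limgS _ _)).
have w_sub X Y : (w (X + Y)%VS + w (X :&: Y)%VS <= w X + w Y)%N.
  rewrite /w !limgD.
  have := rank_mono qm1 (limg_cap p1 X Y); have := rank_mono qm2 (limg_cap p2 X Y).
  have := rank_submod qm1 (p1 @: X) (p1 @: Y).
  have := rank_submod qm2 (p2 @: X) (p2 @: Y); lia.
split=> [V _|V U sVU _|V U _ _].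
- have := dsum_rank_le (sub0v V); rewrite dimv0 /w !limg0.
  by rewrite (rank0 qm1) (rank0 qm2) !addn0 add0n.
- have [X sX eX] := dsum_rank_attained U.
  have := dsum_rank_le (capvSr X V); have := w_mono _ _ (capvSl X V).
  have := dimv_sum_cap X V.
  have /dimvS : (X + V <= U)%VS by rewrite subv_add sX.
  lia.
have [X sX eX] := dsum_rank_attained V; have [Y sY eY] := dsum_rank_attained U.
have := dsum_rank_le (addvS sX sY); have := dsum_rank_le (capvS sX sY).
have := w_sub X Y; have := dimv_sum_cap X Y; have := dimv_sum_cap V U; lia.
Qed.

Hypothesis ker_disj : (lker p2 :&: lker p1 = 0)%VS.

(** On [lker p2] the weight is [rho1] after [p1], and monotone nullity puts the minimum at
    [X = V]. *)
Lemma dsum_isometry_fst : rank_isometry rho rho1 p1 (lker p2).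
Proof.
split=> // V sV.
have wE X : (X <= V)%VS -> w X = rho1 (p1 @: X)%VS.
  move=> sX; have /eqP k2 : (p2 @: X == 0)%VS by rewrite -lkerE (subv_trans sX).
  by rewrite /w k2 (rank0 qm2) addn0.
apply/eqP; rewrite eqn_leq; apply/andP; split.
  have [X sX] := dsum_rank_attained V; rewrite wE // => eX.
  have := rank_unit qm1 (limgS p1 sX); have := limg_dim_le p1 sX; lia.
by have := dsum_rank_le (subvv V); rewrite wE // leq_add2r.
Qed.

Lemma dsum_isometry_snd : rank_isometry rho rho2 p2 (lker p1).
Proof.
split=> [|V sV]; first by rewrite capvC.
have wE X : (X <= V)%VS -> w X = rho2 (p2 @: X)%VS.
  move=> sX; have /eqP k1 : (p1 @: X == 0)%VS by rewrite -lkerE (subv_trans sX).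
  by rewrite /w k1 (rank0 qm1) add0n.
apply/eqP; rewrite eqn_leq; apply/andP; split.
  have [X sX] := dsum_rank_attained V; rewrite wE // => eX.
  have := rank_unit qm2 (limgS p2 sX); have := limg_dim_le p2 sX; lia.
by have := dsum_rank_le (subvv V); rewrite wE // leq_add2r.
Qed.

(** The projections of a minimiser [X] lift to [P] in [lker p2] and [Q] in [lker p1]; joint
    injectivity of [p1] and [p2] gives [X <= P + Q]. *)
Lemma dsum_rank_splits : (p1 @: lker p2 = fullv)%VS -> (p2 @: lker p1 = fullv)%VS ->
  splits rho (lker p2) (lker p1).
Proof.
move=> im1 im2; split=> // V _.
have [X sX eX] := dsum_rank_attained V.
have [P sP eP] : exists2 P, (P <= lker p2)%VS & (p1 @: P = p1 @: X)%VS.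
  by apply: limg_sub_lift; rewrite im1 subvf.
have [Q sQ eQ] : exists2 Q, (Q <= lker p1)%VS & (p2 @: Q = p2 @: X)%VS.
  by apply: limg_sub_lift; rewrite im2 subvf.
exists P, Q; split=> //.
rewrite -(dsum_isometry_fst.2 P sP) -(dsum_isometry_snd.2 Q sQ) eP eQ.
have : (X <= V :&: (P + Q))%VS.
  rewrite subv_cap sX; apply/subvP => x Xx.
  have /memv_imgP[p Pp e1] : p1 x \in (p1 @: P)%VS by rewrite eP memv_img.
  have /memv_imgP[q Qq e2] : p2 x \in (p2 @: Q)%VS by rewrite eQ memv_img.
  have := subvP sP p Pp; rewrite memv_ker => /eqP p0.
  have := subvP sQ q Qq; rewrite memv_ker => /eqP q0.
  suff -> : x = p + q by apply: memv_add.
  apply/eqP; rewrite -subr_eq0 -memv0 -ker_disj memv_cap !memv_ker.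
  by rewrite !linearB !linearD /= e1 e2 p0 q0 !oppr0 add0r addr0 !subrr !eqxx.
move/dimvS; move: eX; rewrite /w; lia.
Qed.

End DirectSum.

(** The summands are the kernels of the opposite projections. Later arguments reach the rank of
    [dsum] only through this lemma. *)
Lemma dsum_splits M N : is_qmatroid M -> is_qmatroid N ->
  is_qmatroid (dsum M N) /\
  exists A B : {vspace qm_E (dsum M N)}, [/\ (A + B = fullv)%VS,
    splits (@qm_rho F (dsum M N)) A B,
    isometric (@qm_rho F (dsum M N)) A (@qm_rho F M) fullv &
    isometric (@qm_rho F (dsum M N)) B (@qm_rho F N) fullv].
Proof.
move=> qmM qmN.
pose p1 : 'Hom(qm_E (dsum M N), qm_E M) := linfun (@fst (qm_E M) (qm_E N)).
pose p2 : 'Hom(qm_E (dsum M N), qm_E N) := linfun (@snd (qm_E M) (qm_E N)).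
have p1E x : p1 x = x.1 by exact: lfunE.
have p2E x : p2 x = x.2 by exact: lfunE.
have rhoE V : @qm_rho F (dsum M N) V = minsub V (fun X =>
  qm_rho (p1 @: X)%VS + qm_rho (p2 @: X)%VS + \dim V - \dim X)%N by [].
have ker0 : (lker p2 :&: lker p1 = 0)%VS.
  apply/eqP; rewrite -subv0; apply/subvP => x /memv_capP[].
  rewrite !memv_ker p1E p2E memv0 => /eqP x2 /eqP x1.
  by rewrite [x]surjective_pairing x1 x2.
have k2 y : ((y, 0) : qm_E (dsum M N)) \in lker p2 by rewrite memv_ker p2E.
have k1 y : ((0, y) : qm_E (dsum M N)) \in lker p1 by rewrite memv_ker p1E.
have im1 : (p1 @: lker p2 = fullv)%VS.
  apply/vspaceP => y; rewrite memvf; apply/memv_imgP; exists (y, 0); last by rewrite p1E.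
  exact: k2.
have im2 : (p2 @: lker p1 = fullv)%VS.
  apply/vspaceP => y; rewrite memvf; apply/memv_imgP; exists (0, y); last by rewrite p2E.
  exact: k1.
split; first exact: dsum_rank_qmatroid rhoE.
exists (lker p2), (lker p1); split.
- apply/vspaceP => -[x y]; rewrite memvf.
  have -> : (x, y) = (x, 0) + (0, y) :> qm_E (dsum M N).
    by congr (_, _); rewrite ?addr0 ?add0r.
  exact: memv_add.
- exact: dsum_rank_splits rhoE _ _ _.
- by exists p1 => //; apply: dsum_isometry_fst rhoE _.
- by exists p2 => //; apply: dsum_isometry_snd rhoE _.
Qed.

Lemma qzero_qmatroid : is_qmatroid (qzero F).
Proof. by split. Qed.

Definition all_summands Ms : Prop :=
  forall i, (i < size Ms)%N -> irr_summand (nth (qzero F) Ms i).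

Lemma all_summands_cons M Ms : all_summands (M :: Ms) <-> irr_summand M /\ all_summands Ms.
Proof.
split=> [h|[hM h] [|i]] //; last by rewrite ltnS; apply: h.
by split=> [|i lti]; [apply: (h 0%N)|apply: (h i.+1)].
Qed.

Lemma dsums_qmatroid Ms : all_summands Ms -> is_qmatroid (dsums Ms).
Proof.
elim: Ms => [_|M [|N Ms] IHs]; first exact: qzero_qmatroid.
  by case/all_summands_cons=> -[].
by case/all_summands_cons=> -[qmM _ _] /IHs qm; case: (dsum_splits qmM qm).
Qed.

(** The internal counterpart of [dsums Ms]; matching by position lets the final reordering be a
    permutation of indices. *)
Definition realizes E (rho : {vspace E} -> nat) (A : {vspace E}) Ms : Prop :=
  exists s, [/\ dec_seq rho s, (\sum_(B <- s) B = A)%VS, size s = size Ms &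
    forall i, (i < size Ms)%N ->
      isometric rho (nth 0%VS s i) (@qm_rho F (nth (qzero F) Ms i)) fullv].

Lemma realizes_isometric E E' rho (A : {vspace E}) rho' (A' : {vspace E'}) Ms :
  isometric rho A rho' A' -> realizes rho A Ms -> realizes rho' A' Ms.
Proof.
case=> f isof <- [s [ds es sz iso]].
exists [seq (f @: B)%VS | B <- s]; rewrite size_map big_map -limg_sum es; split=> //.
  by apply: (isometry_dec_seq isof) ds; rewrite es.
move=> i lti; rewrite (nth_map 0%VS) ?sz //.
apply: isometric_trans (iso i lti); apply: isometric_sym.
by apply: (isometry_restrict isof); rewrite -es sum_sup // mem_nth ?sz.
Qed.

Lemma realizes_cons E rho (A B : {vspace E}) M Ms : splits rho A B ->
  isometric rho A (@qm_rho F M) fullv -> realizes rho B Ms ->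
  realizes rho (A + B)%VS (M :: Ms).
Proof.
move=> sp iA [s [ds es sz iso]]; exists (A :: s); split=> /=.
- by rewrite es.
- by rewrite big_cons es.
- by rewrite sz.
- by case=> [|i] //=; rewrite ltnS; apply: iso.
Qed.

Lemma realizes_dsums Ms : all_summands Ms ->
  realizes (@qm_rho F (dsums Ms)) fullv Ms.
Proof.
elim: Ms => [_|M [|N Ms] IHs].
- exists [::]; split=> //; rewrite big_nil; apply/esym/eqP.
  by rewrite -dimv_eq0 dimvf /dim /= muln0.
(* [dsums [:: M]] is [M] itself and not a sum with [qzero]; the zero space is added so that
   [realizes_cons] still applies. *)
- move=> /all_summands_cons[[qmM _ _] _]; rewrite /= -[fullv]addv0.
  apply: realizes_cons; [exact: splits0|exact: isometric_refl|].
  by exists [::]; split=> //; rewrite big_nil.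
move=> /all_summands_cons[[qmM _ _] irrs]; have qm := dsums_qmatroid irrs.
have [_ [A [B [eAB sp iA iB]]]] := dsum_splits qmM qm.
rewrite [dsums _]/= -/(dsums (N :: Ms)) -eAB.
apply: realizes_cons sp iA _.
exact: realizes_isometric (isometric_sym iB) (IHs irrs).
Qed.

(** * Restrictions as q-matroids on their own ground space *)

Definition restr E (rho : {vspace E} -> nat) (A : {vspace E}) : qmat F :=
  @QMat F (subvs_of A) (fun V => rho (linfun vsval @: V)%VS).

Lemma qmatroid_pullback E E' (f : 'Hom(E, E')) rho :
  qmatroid_on fullv rho -> qmatroid_on fullv (fun V => rho (f @: V)%VS).
Proof.
move=> qm; split=> [V _|V U sVU _|V U _ _].
- by apply: leq_trans (rank_le_dim qm _) _; rewrite -(limg_ker_dim f V) leq_addl.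
- exact: (rank_mono qm (limgS _ sVU)).
rewrite limgD; have := rank_mono qm (limg_cap f V U).
have := rank_submod qm (f @: V) (f @: U); lia.
Qed.

Lemma restr_qmatroid E rho (A : {vspace E}) :
  qmatroid_on fullv rho -> is_qmatroid (restr rho A).
Proof. exact: qmatroid_pullback. Qed.

Lemma restr_isometric E rho (A : {vspace E}) :
  isometric (@qm_rho F (restr rho A)) fullv rho A.
Proof.
exists (linfun vsval).
  split=> //; apply/capv_lkerP => x y _ _; rewrite !lfunE; exact: val_inj.
apply/vspaceP => x; apply/memv_imgP/idP => [[y _ ->]|Ax].
  by rewrite lfunE subvsP.
by exists (vsproj A x); rewrite ?memvf // lfunE /= vsprojK.
Qed.

Lemma restr_irr_summand E rho (A : {vspace E}) : qmatroid_on fullv rho ->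
  irr_space rho A -> irr_summand (restr rho A).
Proof.
move=> qm irr; apply/irr_summandP; first exact: restr_qmatroid.
by apply: isometric_irr irr; apply: isometric_sym; apply: restr_isometric.
Qed.

(** The passage from an internal decomposition to an external sum, needed for existence;
    [realizes_dsums] goes the other way. *)
Lemma dsums_restr E rho (s : seq {vspace E}) : qmatroid_on fullv rho ->
  dec_seq rho s -> {in s, forall A, irr_space rho A} ->
  all_summands [seq restr rho A | A <- s] /\
  isometric rho (\sum_(A <- s) A)%VS
    (@qm_rho F (dsums [seq restr rho A | A <- s])) fullv.
Proof.
move=> qm; elim: s => [_ _|A s IHs [sp ds] irr].
  split=> //; rewrite big_nil; have -> : (fullv : {vspace 'rV[F]_0}) = 0%VS.
    by apply/eqP; rewrite -dimv_eq0 dimvf /dim /= muln0.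
  exists 0; last exact: limg0.
  split=> [|P]; first exact: cap0v.
  by rewrite subv0 => /eqP->; rewrite rank0.
have irrA := restr_irr_summand qm (irr A (mem_head _ _)).
have [|irrs iso] := IHs ds; first by move=> B sB; apply: irr; rewrite inE sB orbT.
split; first exact/all_summands_cons.
have isoA := isometric_sym (restr_isometric rho A).
rewrite big_cons; case: s {IHs irr} ds sp irrs iso => [|B s] ds sp irrs iso.
  by rewrite big_nil addv0.
have qmA := restr_qmatroid A qm; have qms := dsums_qmatroid irrs.
set Ns := [seq _ | _ <- _] in irrs iso qms.
have [qmAs [A' [B' [eAB sp' iA iB]]]] := dsum_splits qmA qms.
rewrite [dsums _]/= -/(dsums Ns) -eAB; apply: isometric_add => //.
  exact: isometric_trans isoA (isometric_sym iA).
exact: isometric_trans iso (isometric_sym iB).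
Qed.

End Transport.

(** The indices that reorder the first components into [s] are applied to the pairs. *)
Lemma perm_unzip1 (T U : eqType) (p : seq (T * U)) (s : seq T) :
  perm_eq (unzip1 p) s -> exists2 p', perm_eq p' p & unzip1 p' = s.
Proof.
case: p => [|x p]; first by rewrite perm_sym => /perm_nilP->; exists [::].
rewrite perm_sym => /(perm_iotaP x.1)[Is pI ->].
rewrite size_map in pI; exists [seq nth x (x :: p) i | i <- Is].
  by apply/(perm_iotaP x); exists Is.
rewrite /unzip1 -map_comp; apply/eq_in_map => i; rewrite (perm_mem pI) mem_iota => /= lti.
by rewrite -(nth_map x x.1).
Qed.

Theorem theorem7p15 (F : finFieldType) (M : qmat F) :
  is_qmatroid M ->
  (exists Ms : seq (qmat F),
      (forall i, (i < size Ms)%N -> irr_summand (nth (qzero F) Ms i)) /\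
      qequiv M (dsums Ms)) /\
  (forall Ms Ns : seq (qmat F),
      (forall i, (i < size Ms)%N -> irr_summand (nth (qzero F) Ms i)) ->
      (forall j, (j < size Ns)%N -> irr_summand (nth (qzero F) Ns j)) ->
      qequiv M (dsums Ms) -> qequiv M (dsums Ns) ->
      size Ns = size Ms /\
      exists sigma : 'S_(size Ms),
        forall i : 'I_(size Ms),
          qequiv (nth (qzero F) Ms i) (nth (qzero F) Ns (sigma i))).
Proof.
move=> qm; split.
  have [s [ds irrs es]] := irr_dec_exists qm fullv.
  have [irrMs iso] := dsums_restr qm ds irrs.
  exists [seq restr (@qm_rho F M) A | A <- s]; split=> //.
  by apply/qequivP; rewrite -es.
move=> Ms Ns irrMs irrNs /qequivP isoM /qequivP isoN.
have [s [ds es szs is_]] := realizes_isometric (isometric_sym isoM) (realizes_dsums irrMs).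
have [t [dt et szt it]] := realizes_isometric (isometric_sym isoN) (realizes_dsums irrNs).
have irr_of Ks u : all_summands Ks -> size u = size Ks ->
    (forall i, (i < size Ks)%N -> isometric (@qm_rho F M) (nth 0%VS u i)
       (@qm_rho F (nth (qzero F) Ks i)) fullv) ->
    {in u, forall A, irr_space (@qm_rho F M) A}.
  move=> irrKs sz iu A uA; rewrite -(nth_index 0%VS uA).
  have lti : (index A u < size Ks)%N by rewrite -sz index_mem.
  have irrK := irrKs _ lti; have [qmK _ _] := irrK.
  exact: isometric_irr (isometric_sym (iu _ lti)) ((irr_summandP qmK).1 irrK).
have [|p [p1 p2 ip]] := dec_seq_unique qm (leqnn (size s)) ds dt
  (irr_of _ _ irrMs szs is_) (irr_of _ _ irrNs szt it).
  by rewrite es et; apply: isometric_refl.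
(* The pairs are arranged to have first components [s]; the second components then permute [t], and
   [tuple_permP] yields [sigma]. *)
have [p' pp' e1] := perm_unzip1 p1.
have szp : size p' = size Ms by rewrite -szs -e1 size_map.
have p2' : perm_eq (unzip2 p') t by apply: perm_trans p2; apply: perm_map.
have szN : size Ns = size Ms by rewrite -szt -(perm_size p2') size_map.
split=> //.
have szt' : size t == size Ms by rewrite szt szN.
have [sigma es2] : exists sigma : 'S_(size Ms),
    unzip2 p' = [tuple tnth (Tuple szt') (sigma i) | i < size Ms].
  exact/tuple_permP.
exists sigma => i; apply/qequivP.
have x0 : {vspace qm_E M} * {vspace qm_E M} := (0%VS, 0%VS).
have lti : (i < size p')%N by rewrite szp.
have := ip (nth x0 p' i); rewrite -(perm_mem pp') mem_nth // => /(_ isT) iso.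
have e1i : (nth x0 p' i).1 = nth 0%VS s i by rewrite -e1 (nth_map x0).
have e2i : (nth x0 p' i).2 = nth 0%VS t (sigma i).
  rewrite -(nth_map x0 0%VS snd) // -/(unzip2 p') es2.
  by rewrite -tnth_nth tnth_mktuple (tnth_nth 0%VS).
rewrite e1i e2i in iso.
apply: isometric_trans (isometric_sym (is_ i (ltn_ord i))) _.
by apply: isometric_trans iso _; apply: it; rewrite szN.
Qed.
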